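(* Let $G$ be a graph. If $\operatorname{girth}(G)\ge 5$, then the bicircular matroid $B(G)$ has no positive double circuits.
   Context: Graphs are finite and may have loops and parallel edges; a loop is a cycle of length $1$ and two parallel edges form a cycle of length $2$. The girth of $G$ is the minimum length of a cycle of $G$ (infinite if $G$ has no cycles). For a set $I$ of edges of $G$, $G[I]$ is the subgraph of $G$ with edge set $I$ and no isolated vertices. The bicircular matroid $B(G)$ is the matroid on the edge set $E$ of $G$ whose independent sets are the sets $I\subseteq E$ such that every connected component of $G[I]$ contains at most one cycle. A double circuit of a matroid $M$ with rank function $r$ is a set $D\subseteq E(M)$ such that $r(D)=|D|-2$ and $r(D-d)=|D|-2$ for every $d\in D$. Every double circuit $D$ has a unique partition $(D_1,\dots,D_k)$ into nonempty classes, called its circuit partition, such that the circuits of $M$ contained in $D$ are exactly the sets $D\setminus D_i$, $i\in\{1,\dots,k\}$. A class $D_i$ is singular if $|D_i|=1$ and multiple otherwise. A double circuit is positive if its circuit partition has more singular classes than multiple classes. *)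

(* Defs.v *)
From mathcomp Require Import all_boot.

Set Implicit Arguments.
Unset Strict Implicit.
Unset Printing Implicit Defensive.

(* A finite graph with loops and parallel edges: a loop is an edge with exactly
   one end. *)
Record graph := Graph {
  vertex : finType;
  edge : finType;
  ends : edge -> {set vertex};
  card_ends : forall e, 0 < #|ends e| <= 2 }.

Section Graph.
Variable G : graph.
Implicit Types (e f : edge G) (I J C : {set edge G}) (x y u : vertex G).

(* Cycles are represented by their edge sets: C is a cycle of length n = #|C|
   when n > 0 and there are distinct vertices v_0, ..., v_(n-1) and distinct
   edges e_0, ..., e_(n-1), forming C, such that e_i joins v_i and v_(i+1),
   with indices modulo n. *)
Definition is_cycle C :=
  (C != set0) &&
  [exists v : {ffun 'I_#|C| -> vertex G}, exists e : {ffun 'I_#|C| -> edge G},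
    [&& injectiveb v, injectiveb e, [set e i | i : 'I_#|C|] == C
      & [forall i, ends (e i) == [set v i; v (ordS i)]]]].

(* None stands for infinity. *)
Definition girth : option nat :=
  if [pick C | is_cycle C] is Some C0
  then Some #|[arg min_(C < C0 | is_cycle C) #|C|]| else None.

Definition girth_ge k := if girth is Some g then k <= g else true.

Definition spanned I := \bigcup_(e in I) ends e.

Definition adjacent I : rel (vertex G) :=
  fun x y => [exists e in I, ends e == [set x; y]].

(* The edge set of the connected component of G[I] that contains the
   vertex x. *)
Definition component I x : {set edge G} :=
  [set e in I | ends e \subset [set y | connect (adjacent I) x y]].

Definition bicircular_indep : {set {set edge G}} :=
  [set I | [forall x in spanned I,
     #|[set C | is_cycle C & C \subset component I x]| <= 1]].

End Graph.

Record matroid (E : finType) := Matroid {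
  indep : {set {set E}};
  indep0 : set0 \in indep;
  indep_sub : forall I J : {set E}, I \subset J -> J \in indep -> I \in indep;
  indep_aug : forall I J : {set E}, I \in indep -> J \in indep -> #|I| < #|J| ->
    exists2 e, e \in J :\: I & e |: I \in indep }.

Section Matroid.
Variables (E : finType) (M : matroid E).
Implicit Types (A C D : {set E}) (P : {set {set E}}).

Definition rank A := \max_(I in indep M | I \subset A) #|I|.

Definition circuit C := minset (fun A => A \notin indep M) C.

(* The "+ 2" on the left avoids truncated subtraction. *)
Definition double_circuit D :=
  (rank D + 2 == #|D|) && [forall d in D, rank (D :\ d) + 2 == #|D|].

Definition circuit_partition D P :=
  partition P D &&
  [forall C : {set E}, (circuit C && (C \subset D)) == [exists A in P, C == D :\: A]].

Definition singular A := #|A| == 1.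
Definition multiple A := ~~ singular A.

Definition positive_double_circuit D :=
  double_circuit D /\
  exists2 P, circuit_partition D P
    & #|[set A in P | multiple A]| < #|[set A in P | singular A]|.

End Matroid.

Section BicircularMatroid.
Variable G : graph.
Implicit Types (e f : edge G) (I J C S : {set edge G}) (x y u z : vertex G).
Implicit Types (R : {set vertex G}) (phi : edge G -> vertex G).

Let conn I := connect (adjacent I).

Lemma is_cycleP C :
  reflect (exists n (v : 'I_n.+1 -> vertex G) (e : 'I_n.+1 -> edge G),
    [/\ injective v, injective e, C = [set e i | i : 'I_n.+1]
      & forall i, ends (e i) = [set v i; v (ordS i)]]) (is_cycle C).
Proof.
apply: (iffP andP) => [[]|].
  rewrite -card_gt0 => C0 /existsP[v /existsP[e]].
  case/and4P=> /injectiveP + /injectiveP + /eqP + /forallP.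
  move: (#|C|) C0 v e => [//|n] _ v e vi ei defC ve.
  by exists n, v, e; split=> // i; apply/eqP/ve.
case=> n; move: n.+1 (ltn0Sn n) => m m0 [v [e [vi ei defC ve]]].
have cC : #|C| = m by rewrite defC card_imset // card_ord.
subst m; rewrite -card_gt0; split=> //.
apply/existsP; exists [ffun i => v i]; apply/existsP; exists [ffun i => e i].
apply/and4P; split.
- by apply/injectiveP=> i j; rewrite !ffunE => /vi.
- by apply/injectiveP=> i j; rewrite !ffunE => /ei.
- by apply/eqP; rewrite [RHS]defC; apply: eq_imset => i; rewrite ffunE.
- by apply/forallP=> i; rewrite !ffunE ve.
Qed.

Lemma spannedP I u : reflect (exists2 e, e \in I & u \in ends e) (u \in spanned I).
Proof. exact: bigcupP. Qed.

Lemma endsE e u : u \in ends e -> exists w, ends e = [set u; w].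
Proof.
move=> ue; have := card_ends e; rewrite (cardsD1 u) ue add1n !ltnS leq0n /=.
case: (set_0Vmem (ends e :\ u)) => [e0 _|[w we]].
  by exists u; rewrite -(setD1K ue) e0 setU0 setUid.
rewrite (cardsD1 w) we add1n ltnS leqn0 cards_eq0 => /eqP e0.
by exists w; rewrite -(setD1K ue) -(setD1K we) e0 setU0.
Qed.

Lemma ends_ex e : exists x y, ends e = [set x; y].
Proof.
have /andP[/card_gt0P[x xe] _] := card_ends e.
by exists x; apply: endsE.
Qed.

Lemma connC I : connect_sym (adjacent I).
Proof.
apply: sym_connect_sym => x y; rewrite /adjacent.
by apply: eq_existsb => e; rewrite setUC.
Qed.

Lemma adjI I e x y : e \in I -> ends e = [set x; y] -> adjacent I x y.
Proof. by move=> eI ee; apply/existsP; exists e; rewrite eI ee eqxx. Qed.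

Lemma conn_ends I e x y : e \in I -> x \in ends e -> y \in ends e -> conn I x y.
Proof.
move=> eI /endsE[w ew]; rewrite ew !inE => /orP[]/eqP->; first exact: connect0.
exact: connect1 (adjI eI ew).
Qed.

Lemma conn_sub I J x y : I \subset J -> conn I x y -> conn J x y.
Proof.
move=> sIJ; apply: connect_sub => a b /existsP[e /andP[eI ee]].
by apply: connect1; apply/existsP; exists e; rewrite (subsetP sIJ) // ee.
Qed.

Lemma conn_cycle C x y : is_cycle C ->
  x \in spanned C -> y \in spanned C -> conn C x y.
Proof.
case/is_cycleP=> n [v [e [vi ei defC ve]]].
have vC i : conn C (v ord0) (v i).
  case: i => i; elim: i => [|i IHi] ltin.
    have -> : Ordinal ltin = ord0 by apply: val_inj.
    exact: connect0.
  apply: connect_trans (IHi (ltnW ltin)) (connect1 _).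
  apply: (@adjI _ (e (Ordinal (ltnW ltin)))); first by rewrite defC imset_f.
  rewrite ve; rewrite (_ : ordS _ = Ordinal ltin) //; apply: val_inj.
  by rewrite /= modn_small.
have sC z : z \in spanned C -> conn C (v ord0) z.
  case/spannedP=> f; rewrite {1}defC => /imsetP[i _ ->]; rewrite ve !inE.
  by case/orP=> /eqP->; apply: vC.
by move=> xC yC; apply: connect_trans (sC _ yC); rewrite /conn connC; apply: sC.
Qed.

Lemma cycle_spanned C : is_cycle C -> exists u, u \in spanned C.
Proof.
case/is_cycleP=> n [v [e [_ _ -> ve]]]; exists (v ord0); apply/spannedP.
by exists (e ord0); rewrite ?imset_f // ve !inE eqxx.
Qed.

Lemma card_spanned_cycle C : is_cycle C -> #|spanned C| = #|C|.
Proof.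
case/is_cycleP=> n [v [e [vi ei defC ve]]].
rewrite {2}defC card_imset // -(card_imset xpredT vi); apply: eq_card => u.
apply/spannedP/imsetP=> [[f]|[i _ ->]].
  rewrite {1}defC => /imsetP[i _ ->]; rewrite ve !inE.
  by case/orP=> /eqP->; [exists i | exists (ordS i)].
by exists (e i); rewrite ?defC ?imset_f // ve !inE eqxx.
Qed.

Lemma sub_cycle C S : is_cycle C -> S \subset C -> S != set0 ->
  #|spanned S| <= #|S| -> S = C.
Proof.
case/is_cycleP=> n [v [e [vi ei defC ve]]] sSC /set0Pn[f fS] leS.
pose A := [set i | e i \in S].
have eA : e @: A = S.
  apply/setP=> g; apply/imsetP/idP => [[i iA ->]|gS]; first by rewrite inE in iA.
  have := subsetP sSC _ gS; rewrite defC => /imsetP[i _ gi].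
  by exists i; rewrite // inE -gi.
have sA : v @: A = spanned S.
  apply/eqP; rewrite eqEcard card_imset // -(card_imset _ ei) eA leS andbT.
  apply/subsetP=> _ /imsetP[i iA ->]; rewrite inE in iA; apply/spannedP.
  by exists (e i); rewrite // ve !inE eqxx.
have AS i : i \in A -> ordS i \in A.
  rewrite inE => iA; rewrite -(mem_imset _ _ vi) sA; apply/spannedP.
  by exists (e i); rewrite // ve !inE eqxx orbT.
have [i iA] : exists i, i \in A.
  by move: fS; rewrite -eA => /imsetP[i iA _]; exists i.
have A0 k : iter k (@ordS n.+1) i \in A by elim: k => //= k; apply: AS.
have itE k : val (iter k (@ordS n.+1) i) = (i + k) %% n.+1.
  elim: k => [|k IHk] /=; first by rewrite addn0 modn_small.
  by rewrite IHk -[(_ %% _).+1]addn1 modnDml addn1 addnS.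
apply/eqP; rewrite eqEsubset sSC defC; apply/subsetP=> _ /imsetP[j _ ->].
suff: j \in A by rewrite inE.
rewrite (_ : j = iter (n.+1 - i + j) (@ordS n.+1) i) //; apply: val_inj.
by rewrite itE addnA subnKC ?modnDl ?modn_small // ltnW.
Qed.

Lemma conn_add_cycle I e x y : e \notin I -> ends e = [set x; y] -> conn I x y ->
  exists C, [/\ is_cycle C, C \subset e |: I & e \in C].
Proof.
move=> eI ee /connectP[p0 p0P yE].
case: (shortenP p0P) yE => p pP pU _ yE {p0 p0P}.
pose n := size p; pose s := x :: p.
have fP i : i < n -> exists2 f, f \in I & ends f = [set nth x s i; nth x s i.+1].
  move=> ltin; have /existsP[f /andP[fI /eqP fe]] := pathP x pP i ltin.
  by exists f.
pose g i := odflt e [pick f in I | ends f == [set nth x s i; nth x s i.+1]].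
have gP i : i < n -> g i \in I /\ ends (g i) = [set nth x s i; nth x s i.+1].
  move=> ltin; rewrite /g; case: pickP => [f /andP[fI /eqP]//|/= none].
  by have [f fI fe] := fP i ltin; have := none f; rewrite fI fe eqxx.
have sU i j : i <= n -> j <= n -> nth x s i = nth x s j -> i = j.
  by move=> ? ? /eqP; rewrite nth_uniq //; apply: eqP.
have gi i j : i < j -> j < n -> g i <> g j.
  move=> ij jn gE; have [_ ei] := gP i (ltn_trans ij jn); have [_ ej] := gP j jn.
  have: nth x s j.+1 \in ends (g i) by rewrite gE ej !inE eqxx orbT.
  rewrite ei !inE => /orP[] /eqP/sU E.
    by have := E jn (ltnW (ltn_trans ij jn)); move=> E'; rewrite -E' ltnNge leqnSn in ij.
  have := E jn (ltn_trans ij jn) => -[E']; by rewrite E' ltnn in ij.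
pose w (i : 'I_n.+1) := nth x s i.
pose h (i : 'I_n.+1) := if i < n then g i else e.
have hn (i : 'I_n.+1) : (i < n) = false -> i = n :> nat.
  by move/negbT; rewrite -leqNgt => ni; apply/eqP; rewrite eqn_leq ni -ltnS ltn_ord.
exists [set h i | i : 'I_n.+1]; split.
- apply/is_cycleP; exists n, w, h; split=> //.
  + by move=> i j /sU E; apply/val_inj/E; rewrite -ltnS.
  + move=> i j; rewrite /h; case: ifP => [li|/hn ni]; case: ifP => [lj|/hn nj].
    * move=> E; apply: val_inj; case: (ltngtP i j) => // ij.
        by case: (gi _ _ ij lj).
      by case: (gi _ _ ij li).
    * by move=> E; have [] := gP i li; rewrite E (negPf eI).
    * by move=> E; have [] := gP j lj; rewrite -E (negPf eI).
    * by move=> _; apply: val_inj; rewrite /= ni nj.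
  + move=> i; rewrite /h /w /=; case: ifP => [li|/hn ni].
      by have [_ ->] := gP i li; rewrite modn_small.
    by rewrite ni modnn /= ee setUC yE (last_nth x).
- apply/subsetP=> _ /imsetP[i _ ->]; rewrite /h; case: ifP => [li|_].
    by have [] := gP i li; rewrite inE orbC => ->.
  exact: setU11.
- by apply/imsetP; exists ord_max; rewrite // /h /= ltnn.
Qed.

Lemma bicircP I :
  reflect (forall C1 C2 x y, is_cycle C1 -> is_cycle C2 ->
      C1 \subset I -> C2 \subset I -> x \in spanned C1 -> y \in spanned C2 ->
      conn I x y -> C1 = C2)
    (I \in bicircular_indep G).
Proof.
rewrite inE; apply: (iffP forall_inP) => [H C1 C2 x y c1 c2 s1 s2 x1 y2 xy|H x xI].
  have xI : x \in spanned I.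
    by case/spannedP: x1 => e e1 xe; apply/spannedP; exists e; rewrite ?(subsetP s1).
  have sub C z : is_cycle C -> C \subset I -> z \in spanned C -> conn I x z ->
      C \in [set C | is_cycle C & C \subset component I x].
    move=> cC sC zC xz; rewrite inE cC; apply/subsetP=> e eC.
    rewrite inE (subsetP sC) //; apply/subsetP=> u ue; rewrite inE.
    apply: connect_trans xz (conn_sub sC (conn_cycle cC zC _)).
    by apply/spannedP; exists e.
  apply: (card_le1_eqP (H x xI)); last exact: sub s1 x1 (connect0 _ _).
  exact: sub s2 y2 xy.
apply/card_le1_eqP=> C1 C2; rewrite !inE => /andP[c1 s1] /andP[c2 s2].
have sI : component I x \subset I by apply/subsetP=> e; rewrite inE => /andP[].
have [a a1] := cycle_spanned c1; have [b b2] := cycle_spanned c2.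
have cx C z : C \subset component I x -> z \in spanned C -> conn I x z.
  move=> sC /spannedP[e eC ze]; have := subsetP sC _ eC; rewrite inE.
  by case/andP=> _ /subsetP/(_ _ ze); rewrite inE.
apply/esym/(H C1 C2 a b) => //; try exact: subset_trans sI.
by apply: connect_trans (cx _ _ s2 b2); rewrite /conn connC; apply: (cx C1).
Qed.

Definition cyclic_at I x :=
  [exists C : {set edge G}, [&& is_cycle C, C \subset I
     & [exists u in spanned C, connect (adjacent I) x u]]].

Lemma cyclic_atP I x :
  reflect (exists C u, [/\ is_cycle C, C \subset I, u \in spanned C & conn I x u])
    (cyclic_at I x).
Proof.
apply: (iffP existsP) => [[C /and3P[cC sC /exists_inP[u uC xu]]]|[C [u [cC sC uC xu]]]].
  by exists C, u.
by exists C; rewrite cC sC; apply/exists_inP; exists u.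
Qed.

Lemma cyclic_conn I x y : conn I x y -> cyclic_at I y -> cyclic_at I x.
Proof.
move=> xy /cyclic_atP[C [u [cC sC uC yu]]]; apply/cyclic_atP; exists C, u.
by split=> //; apply: connect_trans xy yu.
Qed.

Lemma cyclic_sub I J x : I \subset J -> cyclic_at I x -> cyclic_at J x.
Proof.
move=> sIJ /cyclic_atP[C [u [cC sC uC yu]]]; apply/cyclic_atP; exists C, u.
by split=> //; [apply: subset_trans sC sIJ | apply: conn_sub yu].
Qed.

Definition orients phi I :=
  {in I &, injective phi} /\ {in I, forall e, phi e \in ends e}.

Lemma orients_sub phi I J : I \subset J -> orients phi J -> orients phi I.
Proof.
move=> /subsetP s [i h]; split=> [e f eI fI|e eI]; last exact/h/s.
by apply: i; apply: s.
Qed.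

Lemma orients_cycle phi C : is_cycle C -> orients phi C -> phi @: C = spanned C.
Proof.
move=> cC [pi pe]; apply/eqP; rewrite eqEcard card_in_imset //.
rewrite card_spanned_cycle // leqnn andbT.
by apply/subsetP=> _ /imsetP[e eC ->]; apply/spannedP; exists e; rewrite ?pe.
Qed.

Lemma orients_add phi I e z : orients phi I -> z \in ends e ->
  {in I, forall f, phi f != z} ->
  orients (fun f => if f == e then z else phi f) (e |: I).
Proof.
move=> [pi pe] ze pz; split=> [f g|f].
  rewrite !inE; case: eqVneq => [->|_] /=; case: eqVneq => [->|_] //= fI gI.
  - by move/eqP; rewrite eq_sym (negPf (pz _ gI)).
  - by move/eqP; rewrite (negPf (pz _ fI)).
  - exact: pi.
by rewrite !inE; case: eqVneq => [->|_] //= /pe.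
Qed.

Definition step phi I : rel (vertex G) :=
  fun u w => [exists e in I, (phi e == u) && (ends e == [set u; w])].

Lemma stepP phi I u w :
  reflect (exists e, [/\ e \in I, phi e = u & ends e = [set u; w]]) (step phi I u w).
Proof.
apply: (iffP exists_inP) => [[e eI /andP[/eqP pe /eqP ee]]|[e [eI pe ee]]].
  by exists e.
by exists e; rewrite // pe ee !eqxx.
Qed.

(* Following an orientation from a vertex connected to a cycle leads into that
   cycle, and no cycle is ever left. *)
Lemma step_out phi I C u w : orients phi I -> is_cycle C -> C \subset I ->
  connect (step phi I) u w -> u \in spanned C -> w \in spanned C.
Proof.
move=> oI cC sC /connectP[p]; elim: p u => [|a p IHp] u /=; first by move=> _ ->.
case/andP=> /stepP[e [eI pe ee]] pP lE uC; apply: IHp pP lE _.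
have /imsetP[f fC uf] : u \in phi @: C.
  by rewrite (orients_cycle cC (orients_sub sC oI)).
have fe : f = e by apply: oI.1 => //; [apply: (subsetP sC) | rewrite -uf pe].
by apply/spannedP; exists e; rewrite -?fe // fe ee !inE eqxx orbT.
Qed.

Lemma step_in phi I C u w : orients phi I -> is_cycle C -> C \subset I ->
  w \in spanned C -> conn I w u ->
  exists2 a, a \in spanned C & connect (step phi I) u a.
Proof.
move=> oI cC sC wC.
pose U := [set z | [exists a in spanned C, connect (step phi I) z a]].
have UC z : z \in spanned C -> z \in U.
  by move=> zC; rewrite inE; apply/exists_inP; exists z.
suff cl : closed (adjacent I) [in U].
  move=> /(closed_connect cl); rewrite [w \in _]UC // => /esym.
  by rewrite inE => /exists_inP.
have st a b : step phi I a b -> (a \in U) = (b \in U).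
  move=> ab; apply/idP/idP; rewrite inE => /exists_inP[c cc].
    case/connectP=> [[|b' p]] /=; last first.
      case/andP=> /stepP[e' [eI' pe' ee']] pP cE.
      case/stepP: ab => e [eI pe ee].
      have ee1 : e' = e by apply: oI.1 => //; rewrite pe.
      have -> : b = b'.
        move: ee ee'; rewrite ee1 => -> /setP E.
        have := E b; have := E b'; rewrite !inE !eqxx !orbT.
        by case: eqVneq => [->|_] /=; [case: eqVneq => [->//|_] /= _ /esym/eqP|
           move/eqP].
      rewrite inE; apply/exists_inP; exists c => //; apply/connectP; by exists p.
    move=> _ ca; rewrite ca in cc; apply: UC.
    exact: step_out oI cC sC (connect1 ab) cc.
  move=> bc; rewrite inE; apply/exists_inP; exists c => //.
  exact: connect_trans (connect1 ab) bc.
move=> a b /existsP[e /andP[eI /eqP ee]].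
have := oI.2 _ eI; rewrite ee => /set2P[] pe.
  by apply: st; apply/stepP; exists e.
by apply/esym/st; apply/stepP; exists e; rewrite setUC.
Qed.

Lemma orients_bicirc phi I : orients phi I -> I \in bicircular_indep G.
Proof.
move=> oI; apply/bicircP=> C1 C2 x y c1 c2 s1 s2 x1 y2 xy.
have [z z1 yz] := step_in oI c1 s1 x1 xy.
have z2 := step_out oI c2 s2 yz y2.
have [o1 o2] := (orients_cycle c1 (orients_sub s1 oI),
                 orients_cycle c2 (orients_sub s2 oI)).
have o12 : phi @: (C1 :&: C2) = spanned C1 :&: spanned C2.
  rewrite -o1 -o2; apply/setP=> u; rewrite inE; apply/imsetP/andP.
    by case=> e; rewrite inE => /andP[e1 e2] ->; rewrite !imset_f.
  case=> /imsetP[e e1 ->] /imsetP[f f2 ef].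
  have E : e = f by apply: oI.1 => //; [apply: (subsetP s1) | apply: (subsetP s2)].
  by exists e; rewrite // inE e1 E.
have n0 : C1 :&: C2 != set0.
  have: z \in phi @: (C1 :&: C2) by rewrite o12 inE z1.
  by case/imsetP=> e eC _; apply/set0Pn; exists e.
have le : #|spanned (C1 :&: C2)| <= #|C1 :&: C2|.
  apply: leq_trans (leq_imset_card phi _); rewrite o12; apply: subset_leq_card.
  apply/subsetP=> u /spannedP[e]; rewrite !inE => /andP[e1 e2] ue.
  by apply/andP; split; apply/spannedP; exists e.
by rewrite -(sub_cycle c1 (subsetIl _ _) n0 le) (sub_cycle c2 (subsetIr _ _) n0 le).
Qed.

Lemma bicirc_sub I J : I \subset J -> J \in bicircular_indep G ->
  I \in bicircular_indep G.
Proof.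
move=> sIJ /bicircP H; apply/bicircP=> C1 C2 x y c1 c2 s1 s2 x1 y2 xy.
by apply: H (conn_sub sIJ xy) => //; apply: subset_trans sIJ.
Qed.

Lemma bicirc_orients I R : I \in bicircular_indep G ->
  {in R &, forall r s, conn I r s -> r = s} -> {in R, forall r, ~~ cyclic_at I r} ->
  exists2 phi, orients phi I & {in I, forall e, phi e \notin R}.
Proof.
have [n] := ubnP #|I|; elim: n I R => // n IHn I R leIn bI RU RA.
have [I0|[e eI]] := set_0Vmem I.
  have [V0|/card_gt0P[x0 _]] := posnP #|vertex G|.
    suff nE : edge G -> False by exists (fun e => match nE e with end) => [|e];
      [split=> e | case: (nE e)]; case: (nE e).
    move=> e; have /andP[/card_gt0P[x _] _] := card_ends e.
    by have := card0_eq V0 x; rewrite inE.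
  by exists (fun=> x0); [split=> [e f|e]|move=> e]; rewrite I0 inE.
pose I' := I :\ e; have sI : I' \subset I by apply: subsetDl.
have eI' : e \notin I' by rewrite !inE eqxx.
have bI' := bicirc_sub sI bI.
have cI x y : x \in ends e -> y \in ends e -> conn I x y by apply: conn_ends.
suff [z [ze zA zR]] : exists z, [/\ z \in ends e, ~~ cyclic_at I' z
    & {in R, forall r, ~~ conn I' r z}].
  have [||||phi oI' pR] := IHn I' (z |: R).
  - by move: leIn; rewrite (cardsD1 e) eI.
  - exact: bI'.
  - move=> r s; rewrite !inE => /orP[/eqP->|rR] /orP[/eqP->|sR] // rs.
    + by have := zR _ sR; rewrite /conn connC [connect _ _ _]rs.
    + by have := zR _ rR; rewrite rs.
    + exact: RU (conn_sub sI rs).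
  - move=> r; rewrite !inE => /orP[/eqP->//|/RA]; apply: contra; exact: cyclic_sub.
  rewrite -(setD1K eI) -/I'; eexists.
    by apply: (orients_add oI' ze) => f /pR; rewrite !inE negb_or => /andP[].
  move=> f; rewrite in_setU1; case: eqP => [_ _|_ /= /pR]; last by rewrite inE negb_or => /andP[].
  by apply/negP=> /zR; rewrite /conn connect0.
have [x [y ee]] := ends_ex e.
have [xe ye] : x \in ends e /\ y \in ends e by rewrite ee !inE !eqxx orbT.
have [xy|nxy] := boolP (conn I' x y).
  have [C [cC]] := conn_add_cycle eI' ee xy; rewrite setD1K // => sC eC.
  have xC : x \in spanned C by apply/spannedP; exists e.
  exists x; split=> //.
    apply/negP=> /cyclic_atP[C' [u [cC' sC' uC' xu]]].
    have sC2 := subset_trans sC' sI.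
    have E := bicircP _ bI _ _ _ _ cC cC' sC sC2 xC uC' (conn_sub sI xu).
    by move: eC; rewrite E => /(subsetP sC'); rewrite (negPf eI').
  move=> r rR; apply: contra (RA _ rR) => /(conn_sub sI) rx.
  by apply/cyclic_atP; exists C, x.
have sel z z' r : z \in ends e -> z' \in ends e -> ~~ conn I' z z' -> r \in R ->
    conn I' r z -> exists z, [/\ z \in ends e, ~~ cyclic_at I' z
    & {in R, forall r, ~~ conn I' r z}].
  move=> ze ze' nzz rR rz; exists z'.
  have rz' : conn I r z' by apply: connect_trans (conn_sub sI rz) (cI _ _ ze ze').
  split=> //; first by apply: contra (RA _ rR) => /(cyclic_sub sI); apply: cyclic_conn.
  move=> s sR; apply: contra nzz => sz.
  have E : r = s.
    apply: RU => //; apply: connect_trans rz' _.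
    by rewrite connC; apply: conn_sub sz.
  by apply: connect_trans sz; rewrite connC -E.
have [/exists_inP[r rR rx]|nx] := boolP [exists r in R, connect (adjacent I') r x].
  exact: (sel x y r).
have [/exists_inP[r rR ry]|ny] := boolP [exists r in R, connect (adjacent I') r y].
  by apply: (sel y x r) => //; rewrite /conn connC.
have [cx|ax] := boolP (cyclic_at I' x); last first.
  by exists x; split=> // r rR; apply: contra nx => rx; apply/exists_inP; exists r.
exists y; split=> //; last first.
  by move=> r rR; apply: contra ny => ry; apply/exists_inP; exists r.
apply: contra nxy => /cyclic_atP[C2 [v [c2 s2 v2 yv]]].
case/cyclic_atP: cx => C1 [u [c1 s1 u1 xu]].
have uv : conn I u v.
  apply: connect_trans (conn_sub sI yv); apply: connect_trans (cI _ _ xe ye).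
  by rewrite connC; apply: conn_sub xu.
have E := bicircP _ bI _ _ _ _ c1 c2 (subset_trans s1 sI) (subset_trans s2 sI) u1 v2 uv.
apply: connect_trans xu _; rewrite connC; apply: connect_trans yv _.
by apply: conn_sub s2 (conn_cycle c2 v2 _); rewrite -E.
Qed.

Lemma bicirc0 : set0 \in bicircular_indep G.
Proof.
apply/bicircP=> C1 C2 x y _ _ /subsetP s1 _ /spannedP[e /s1]; by rewrite inE.
Qed.

Lemma bicirc_aug I J : I \in bicircular_indep G -> J \in bicircular_indep G ->
  #|I| < #|J| -> exists2 e, e \in J :\: I & e |: I \in bicircular_indep G.
Proof.
move=> bI bJ ltIJ; apply/exists_inP; apply: contraLR ltIJ => noadd.
have [||phi oI _] := bicirc_orients (R := set0) bI; try by move=> r; rewrite inE.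
have [||psi oJ _] := bicirc_orients (R := set0) bJ; try by move=> r; rewrite inE.
pose W := [set x | cyclic_at I x].
have JW e x : e \in J :\: I -> x \in ends e -> x \in W.
  move=> eJI xe; rewrite inE; apply: contraR noadd => xA.
  have [r s|r|chi oc cx] := bicirc_orients (R := [set x]) bI.
  - by rewrite !inE => /eqP-> /eqP->.
  - by rewrite inE => /eqP->.
  apply/exists_inP; exists e => //; apply: orients_bicirc (orients_add oc xe _).
  by move=> f /cx; rewrite inE.
have Wphi x : x \in W -> x \in phi @: I.
  rewrite inE => /cyclic_atP[C [u [cC sC uC xu]]].
  have [a aC /connectP[[|b p] /= pP aE]] : exists2 a, a \in spanned C & connect (step phi I) x a.
  - by apply: step_in oI cC sC uC _; rewrite /conn connC.
  - move: aC; rewrite aE -(orients_cycle cC (orients_sub sC oI)).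
    by case/imsetP=> f fC ->; rewrite imset_f // (subsetP sC).
  - by case/andP: pP => /stepP[e [eI <- _]] _; apply: imset_f.
pose T := [set f in I | phi f \in W].
have sT : T \subset I by apply/subsetP=> f; rewrite inE => /andP[].
have cT : #|T| = #|W|.
  rewrite -(card_in_imset (sub_in2 (subsetP sT) oI.1)); apply: eq_card => x.
  apply/imsetP/idP => [[f]|xW]; first by rewrite inE => /andP[_ fW] ->.
  by have /imsetP[f fI E] := Wphi x xW; exists f; rewrite // inE fI -E.
have J1 : #|J :&: (I :\: T)| <= #|I :\: T| by apply/subset_leq_card/subsetIr.
have J2 : #|J :\: (I :\: T)| <= #|W|.
  have sJ : J :\: (I :\: T) \subset J by apply: subsetDl.
  rewrite -(card_in_imset (sub_in2 (subsetP sJ) oJ.1)); apply: subset_leq_card.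
  apply/subsetP=> _ /imsetP[e eX ->].
  have eJ := subsetP sJ _ eX; have pe := oJ.2 _ eJ.
  have [eI|eI] := boolP (e \in I); last by apply: JW pe; rewrite inE eI.
  have: e \in T by move: eX; rewrite !in_setD eI eJ !andbT negbK.
  rewrite !inE eI /=; apply: cyclic_conn; exact: conn_ends eI pe (oI.2 _ eI).
rewrite -leqNgt -(cardsID (I :\: T) J) -(cardsID T I) (setIidPr sT) cT addnC.
exact: leq_add.
Qed.

Definition bicircular_matroid : matroid (edge G) :=
  Matroid bicirc0 bicirc_sub bicirc_aug.

End BicircularMatroid.

(* Main.v *)
(* Write V(A) for the set of ends of the edges in A. A circuit C of B(G) has
   |V(C)| + 1 edges and minimum degree at least 2, and submodularity gives
   |D| = |V(D)| + 2 for the double circuit D. Hence a class D_i has one more edge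
   than there are vertices of V(D) outside V(D - D_i). These vertex sets are
   disjoint, so the set X of the other vertices, those lying in every
   V(D - D_i), has k - 2 elements, k being the number of classes. Vertices in X
   have degree at least 3 in G[D], the others at least 2, and the degree sum is
   at most 2|D| = 2|V(D)| + 4, so |X| <= 4. The s singular edges have all their
   ends in X, so by the girth condition they form a forest, and if s > 0 then
   s <= |X| - 1 = k - 3. Hence s <= 3, and at least 3 classes are multiple. *)

Require Import Defs.
From mathcomp Require Import all_boot.
From mathcomp Require Import zify.

Set Implicit Arguments.
Unset Strict Implicit.
Unset Printing Implicit Defensive.

Section BicircularCircuits.
Variable G : graph.
Implicit Types (e : edge G) (A C D I : {set edge G}) (x : vertex G).
Implicit Types (P : {set {set edge G}}).

Let M := bicircular_matroid G.

(** * Independent sets and the vertices they span *)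

Lemma girth_ge_cycle k C : girth_ge G k -> is_cycle C -> k <= #|C|.
Proof.
rewrite /girth_ge /girth; case: pickP => [C0 cC0|none] => [|_]; last by rewrite none.
by case: arg_minnP => // C1 _ minC1 kC1 cC; apply: leq_trans kC1 (minC1 _ cC).
Qed.

Lemma spanned_sub A I : A \subset I -> spanned A \subset spanned I.
Proof.
move=> sAI; apply/subsetP=> x /spannedP[e eA xe].
by apply/spannedP; exists e; rewrite ?(subsetP sAI).
Qed.

Lemma spannedU A I : spanned (A :|: I) = spanned A :|: spanned I.
Proof. exact: bigcup_setU. Qed.

(** An orientation assigns to each edge of [I] one of its ends, injectively. *)
Lemma bicirc_card I : I \in bicircular_indep G -> #|I| <= #|spanned I|.
Proof.
move=> bI.
have [||phi oI _] := bicirc_orients (R := set0) bI; try by move=> r; rewrite inE.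
rewrite -(card_in_imset oI.1); apply: subset_leq_card.
by apply/subsetP=> _ /imsetP[e eI ->]; apply/spannedP; exists e; rewrite // oI.2.
Qed.

(* An edge e that cannot be added to I has all its ends in W, the union of the
   components of G[I] that contain a cycle; these components have exactly #|W|
   edges, hence together with e they are overfull. *)
Lemma bicirc_overfull I e : I \in bicircular_indep G -> e \notin I ->
  e |: I \notin bicircular_indep G ->
  exists2 A : {set edge G}, A \subset e |: I & #|spanned A| < #|A|.
Proof.
move=> bI eI dep.
have [||phi oI _] := bicirc_orients (R := set0) bI; try by move=> r; rewrite inE.
pose W := [set x | cyclic_at I x].
have eW x : x \in ends e -> x \in W.
  move=> xe; rewrite inE; apply: contraR dep => xA.
  have [r s|r|chi oc cx] := bicirc_orients (R := [set x]) bI.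
  - by rewrite !inE => /eqP-> /eqP->.
  - by rewrite inE => /eqP->.
  apply: orients_bicirc (orients_add oc xe _).
  by move=> f /cx; rewrite inE.
have Wphi x : x \in W -> x \in phi @: I.
  rewrite inE => /cyclic_atP[C [u [cC sC uC xu]]].
  have [|a aC /connectP[[|b p] /= pP aE]] := step_in (u := x) oI cC sC uC.
  - by rewrite connC.
  - move: aC; rewrite aE -(orients_cycle cC (orients_sub sC oI)).
    by case/imsetP=> f fC ->; rewrite imset_f // (subsetP sC).
  - by case/andP: pP => /stepP[f [fI <- _]] _; apply: imset_f.
pose T := [set f in I | phi f \in W].
have sT : T \subset I by apply/subsetP=> f; rewrite inE => /andP[].
have leWT : #|W| <= #|T|.
  apply: leq_trans (leq_imset_card phi T); apply/subset_leq_card/subsetP=> x xW.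
  by have /imsetP[f fI E] := Wphi x xW; rewrite E imset_f // inE fI -E.
exists (e |: T); first exact: setUS.
rewrite cardsU1 (contra (subsetP sT e) eI) add1n ltnS; apply: leq_trans leWT.
apply/subset_leq_card/subsetP=> x /spannedP[f]; rewrite in_setU1.
case: eqP => [-> _|_ /=]; first exact: eW.
rewrite !inE => /andP[fI fW] xf; apply: cyclic_conn fW.
exact: conn_ends fI xf (oI.2 _ fI).
Qed.

(** * Circuits of the bicircular matroid *)

Lemma circuit_indep C A : circuit M C -> A \proper C -> A \in bicircular_indep G.
Proof.
case/minsetP=> _ minC sAC; apply: contraLR sAC => dep.
by apply/negP=> pAC; have := properxx C; rewrite -{1}(minC A dep (proper_sub pAC)) pAC.
Qed.

Lemma circuit_neq0 C : circuit M C -> C != set0.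
Proof. by case/minsetP=> dep _; apply: contraNneq dep => ->; apply: bicirc0. Qed.

(** Deleting an edge leaves an independent set, which bounds #|C| from above. Conversely, an
    overfull subset of [C] is dependent, hence equal to [C] by minimality. *)
Lemma circuit_card C : circuit M C -> #|C| = #|spanned C|.+1.
Proof.
move=> cC; have [e eC] := set0Pn _ (circuit_neq0 cC).
have pC := properD1 eC; have bC := circuit_indep cC pC.
have [A sAC ltA] : exists2 A : {set edge G}, A \subset C & #|spanned A| < #|A|.
  rewrite -(setD1K eC); apply: bicirc_overfull bC _ _.
    by rewrite !inE eqxx.
  by rewrite setD1K //; case/minsetP: cC.
have eqAC : A = C.
  case/minsetP: cC => _; apply=> //.
  by apply/negP=> /bicirc_card; rewrite leqNgt ltA.
apply/eqP; rewrite eqn_leq -{3 4}eqAC ltA andbT (cardsD1 e) eC add1n ltnS.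
exact: leq_trans (bicirc_card bC) (subset_leq_card (spanned_sub (proper_sub pC))).
Qed.

(** * Degrees and forests *)

Definition degree I x := #|[set e in I | x \in ends e]|.

Lemma degree_sub A I x : A \subset I -> degree A x <= degree I x.
Proof.
move=> sAI; apply/subset_leq_card/subsetP=> e; rewrite !inE => /andP[eA ->].
by rewrite (subsetP sAI).
Qed.

(** Double counting; a loop contributes only 1. *)
Lemma sum_degree I : \sum_(x in spanned I) degree I x <= #|I|.*2.
Proof.
under eq_bigr => x _ do rewrite /degree -sum1_card.
rewrite (exchange_big_dep [in I]) /=; last first.
  by move=> x e _; rewrite inE => /andP[].
rewrite -muln2 -sum_nat_const; apply: leq_sum => e eI.
rewrite sum1_card; apply: leq_trans (_ : #|ends e| <= 2).
  by apply/subset_leq_card/subsetP=> x /andP[_]; rewrite inE => /andP[].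
by have /andP[] := card_ends e.
Qed.

(** If [e] were the only edge at [x], then [C :\ e] would keep |V(C)| edges but miss [x], too many
    for an independent set. *)
Lemma circuit_degree C x : circuit M C -> x \in spanned C -> 1 < degree C x.
Proof.
move=> cC xC; rewrite ltnNge; apply/negP=> /card_le1_eqP deg1.
have /spannedP[e eC xe] := xC.
have bC := circuit_indep cC (properD1 eC).
have := bicirc_card bC; apply/negP; rewrite -ltnNge.
have -> : #|C :\ e| = #|spanned C|.
  by have := circuit_card cC; rewrite (cardsD1 e) eC => -[].
apply/proper_card/properP; split; first exact/spanned_sub/subsetDl.
exists x => //; apply/negP=> /spannedP[f /setD1P[/eqP nfe fC] xf].
by apply: nfe; apply: deg1; rewrite inE ?eC ?fC.
Qed.

(** Without cycles, an orientation can avoid a chosen vertex [r], so the edges inject into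
    [X :\ r]. *)
Lemma acyclic_card I (X : {set vertex G}) : (forall C, C \subset I -> ~~ is_cycle C) ->
  I != set0 -> spanned I \subset X -> #|I| < #|X|.
Proof.
move=> acI /set0Pn[e eI] sIX.
have /andP[/card_gt0P[r re] _] := card_ends e.
have rX : r \in X by apply/(subsetP sIX)/spannedP; exists e.
have bI : I \in bicircular_indep G.
  by apply/bicircP=> C1 C2 x y c1 _ /acI; rewrite c1.
have [s t|s _|phi oI phir] := bicirc_orients (R := [set r]) bI.
- by rewrite !inE => /eqP-> /eqP->.
- by apply/negP=> /cyclic_atP[C [u [cC /acI]]]; rewrite cC.
rewrite (cardsD1 r X) rX add1n ltnS -(card_in_imset oI.1).
apply/subset_leq_card/subsetP=> _ /imsetP[f fI ->].
have := phir f fI; rewrite !inE => -> /=.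
by apply/(subsetP sIX)/spannedP; exists f; rewrite // oI.2.
Qed.

(** * Double circuits *)

Section DoubleCircuit.
Variables (D : {set edge G}) (P : {set {set edge G}}).
Hypotheses (dcD : double_circuit M D) (cpP : circuit_partition M D P).
Hypothesis P0 : P != set0.

Let partP : partition P D. Proof. by case/andP: cpP. Qed.

Let sPD A : A \in P -> A \subset D.
Proof. by move=> AP; rewrite -(cover_partition partP) bigcup_sup. Qed.

Lemma circuit_setD A : A \in P -> circuit M (D :\: A).
Proof.
case/andP: cpP => _ /forallP/(_ (D :\: A))/eqP DA_circuit AP.
suff: circuit M (D :\: A) && (D :\: A \subset D) by case/andP.
by rewrite DA_circuit; apply/exists_inP; exists A.
Qed.

Lemma partition_disjoint A B : A \in P -> B \in P -> A != B -> [disjoint A & B].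
Proof. by case/and3P: partP => _ /trivIsetP tP _; apply: tP. Qed.

Lemma setD_cover A B : A \in P -> B \in P -> A != B -> (D :\: A) :|: (D :\: B) = D.
Proof.
move=> AP BP nAB; have := partition_disjoint AP BP nAB.
by rewrite -setI_eq0 => /eqP AB0; rewrite -setDIr AB0 setD0.
Qed.

(** If [A] were the only class, the circuit [D :\: A] would be empty. *)
Lemma partition_other A : A \in P -> exists2 B, B \in P & A != B.
Proof.
move=> AP; have [/exists_inP[B BP nAB]|] := boolP [exists B in P, A != B].
  by exists B.
move=> /exists_inPn none.
have PA : P = [set A].
  apply/setP=> B; rewrite inE; apply/idP/eqP => [/none|->//].
  by rewrite negbK => /eqP.
have := circuit_neq0 (circuit_setD AP).
by rewrite -(cover_partition partP) PA cover1 setDv eqxx.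
Qed.

(** The rank is at most |V(D)|, which gives one bound. For the other, two circuits [D :\: A] and
    [D :\: B] have union [D] and independent intersection; inclusion-exclusion is applied to them
    and to their vertex sets. *)
Lemma double_circuit_card : #|D| = #|spanned D| + 2.
Proof.
apply/eqP; rewrite eqn_leq; apply/andP; split.
  case/andP: dcD => /eqP <- _; rewrite leq_add2r; apply/bigmax_leqP=> I /andP[bI sID].
  exact: leq_trans (bicirc_card bI) (subset_leq_card (spanned_sub sID)).
have [A AP] := set0Pn _ P0; have [B BP nAB] := partition_other AP.
have [cA cB] := (circuit_setD AP, circuit_setD BP).
have bAB : (D :\: A) :&: (D :\: B) \in bicircular_indep G.
  apply: (circuit_indep cA); rewrite properE subsetIl /=; apply/negP.
  rewrite subsetI subxx /= => sAB.
  have := setD_cover AP BP nAB; rewrite (setUidPr sAB) => /setP DB.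
  have /set0Pn[e eB] : B != set0 by case/and3P: partP => _ _; apply: contraNneq => <-.
  by have := DB e; rewrite !inE eB (subsetP (sPD BP)).
have cAB := leq_trans (bicirc_card bAB) (subset_leq_card
  (_ : _ \subset spanned (D :\: A) :&: spanned (D :\: B))).
have := cAB; rewrite subsetI !spanned_sub ?subsetIl ?subsetIr // => /(_ isT) leI.
have := cardsUI (D :\: A) (D :\: B).
have := cardsUI (spanned (D :\: A)) (spanned (D :\: B)).
rewrite -spannedU (setD_cover AP BP nAB) (circuit_card cA) (circuit_card cB).
lia.
Qed.

(** * Vertices common to all circuits in [D] *)

Let X := [set x in spanned D | [forall A in P, x \in spanned (D :\: A)]].

Lemma card_class A : A \in P -> #|A| = #|spanned D :\: spanned (D :\: A)|.+1.
Proof.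
move=> AP; have := circuit_card (circuit_setD AP); have := double_circuit_card.
rewrite !cardsDS ?sPD //; last exact/spanned_sub/subsetDl.
have := subset_leq_card (sPD AP).
have := subset_leq_card (spanned_sub (subsetDl D A)).
lia.
Qed.

(** Summing [card_class] shows that |V(D)| + 2 is #|P| plus the numbers of vertices lost with each
    class; these vertices lie outside [X]. *)
Lemma card_branch : #|X| + 2 <= #|P|.
Proof.
have sX : X \subset spanned D by apply/subsetP=> x; rewrite inE => /andP[].
suff leW : \sum_(A in P) #|spanned D :\: spanned (D :\: A)| <= #|spanned D :\: X|.
  have := card_partition partP; rewrite (eq_bigr _ card_class).
  under eq_bigr do rewrite -addn1.
  rewrite big_split /= sum1_card double_circuit_card.
  move: leW; rewrite cardsDS //; have := subset_leq_card sX.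
  move: #|X| #|P| #|spanned D| (\sum_(A in P) _) => m n p w; lia.
under eq_bigr => A _ do rewrite -sum1_card.
rewrite (exchange_big_dep [in spanned D :\: X]) /=; last first.
  move=> A x AP; rewrite !inE => /andP[xA xD]; rewrite xD andbT /=.
  by apply/forall_inPn; exists A.
(* No vertex is lost with two classes, since the two circuits cover [D]. *)
rewrite -sum1_card; apply: leq_sum => x /setDP[xD _].
rewrite sum1_card; apply/card_le1_eqP=> A B.
case/andP=> AP /setDP[_ xA] /andP[BP /setDP[_ xB]].
apply/eqP; apply: contraLR xD => nAB.
by rewrite -(setD_cover BP AP nAB) spannedU inE negb_or xB.
Qed.

(** If an edge [e] at [x] lies in the class [A], the circuit [D :\: A] has two further edges at
    [x]. *)
Lemma branch_degree x : x \in X -> 2 < degree D x.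
Proof.
rewrite inE => /andP[/spannedP[e eD xe] /forall_inP xP].
have /bigcupP[A AP eA] : e \in cover P by rewrite (cover_partition partP).
have := circuit_degree (circuit_setD AP) (xP A AP).
rewrite /(degree D x) (cardsD1 e) inE eD xe /= add1n ltnS.
move/leq_trans; apply; apply/subset_leq_card/subsetP=> f.
rewrite !inE => /andP[/andP[nfA ->] ->]; rewrite !andbT.
by apply: contraNneq nfA => ->.
Qed.

Lemma double_circuit_degree x : x \in spanned D -> 1 < degree D x.
Proof.
move=> xD; have [A AP] := set0Pn _ P0; have [B BP nAB] := partition_other AP.
suff [C CP xC] : exists2 C, C \in P & x \in spanned (D :\: C).
  apply: leq_trans (circuit_degree (circuit_setD CP) xC) _.
  exact/degree_sub/subsetDl.
move: xD; rewrite -{1}(setD_cover AP BP nAB) spannedU inE.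
by case/orP; [exists A | exists B].
Qed.

Lemma card_branch_le4 : #|X| <= 4.
Proof.
have sX : X \subset spanned D by apply/subsetP=> x; rewrite inE => /andP[].
have := sum_degree D.
have : \sum_(x in spanned D) (2 + (x \in X)) <= \sum_(x in spanned D) degree D x.
  apply: leq_sum => x xD; case: (boolP (x \in X)) => [/branch_degree//|_].
  exact: double_circuit_degree.
rewrite big_split /= sum_nat_const -big_mkcondr sum1_card double_circuit_card.
have -> : #|[pred x in spanned D | x \in X]| = #|X|.
  by apply: eq_card => x; rewrite inE /= andb_idl //; apply: (subsetP sX).
lia.
Qed.

(** * Singular classes *)

Lemma singular_spanned e : [set e] \in P -> ends e \subset X.
Proof.
move=> eP; have eD : e \in D by rewrite -sub1set sPD.
apply/subsetP=> x xe; have xD : x \in spanned D by apply/spannedP; exists e.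
rewrite inE xD; apply/forall_inP=> A AP; have [eA|neA] := eqVneq [set e] A.
  (* By [card_class], deleting a class of one edge loses no vertex. *)
  have := card_class AP; rewrite -eA cards1 => -[/esym/eqP]; rewrite cards_eq0 setD_eq0.
  by move/subsetP; apply.
apply/spannedP; exists e => //; rewrite inE eD andbT.
by have := partition_disjoint eP AP neA; rewrite disjoints1.
Qed.

Lemma singular_le_multiple : girth_ge G 5 ->
  #|[set A in P | singular A]| <= #|[set A in P | multiple A]|.
Proof.
move=> g5; pose S := [set e | [set e] \in P].
have := cardsID [set A | singular A] P.
have <- : #|[set A in P | multiple A]| = #|P :\: [set A | singular A]|.
  by apply: eq_card => A; rewrite !inE andbC.
have -> : #|P :&: [set A | singular A]| = #|[set A in P | singular A]|.
  by apply: eq_card => A; rewrite !inE.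
have -> : #|[set A in P | singular A]| = #|S|.
  rewrite -(card_imset S (@set1_inj _)); apply: eq_card => A; rewrite inE.
  apply/andP/imsetP=> [[AP /cards1P[e eA]]|[e eS ->]].
    by exists e; rewrite // inE -eA.
  by rewrite /singular cards1; rewrite inE in eS.
have [->|S0] := eqVneq S set0; first by rewrite cards0.
move=> cardP; have sSX : spanned S \subset X.
  apply/subsetP=> x /spannedP[e]; rewrite inE => /singular_spanned/subsetP; exact.
suff ltSX : #|S| < #|X|.
  (* As #|S| <= #|X| - 1 <= 3 and #|P| >= #|X| + 2, at least 3 classes are multiple. *)
  move: ltSX cardP card_branch card_branch_le4.
  by move: #|S| #|X| #|P| #|[set A in P | multiple A]| => s n p m; lia.
apply: acyclic_card => // C sCS; apply/negP=> cC.
(* A cycle has as many edges as vertices, here at most #|X| <= 4. *)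
have := girth_ge_cycle g5 cC; rewrite -(card_spanned_cycle cC) leqNgt ltnS.
rewrite (leq_trans _ card_branch_le4) // subset_leq_card //.
exact: subset_trans (spanned_sub sCS) sSX.
Qed.

End DoubleCircuit.
End BicircularCircuits.

Theorem theorem11 (G : graph) :
  girth_ge G 5 ->
  ~ (exists D : {set edge G}, positive_double_circuit (bicircular_matroid G) D).
Proof.
move=> g5 [D [dcD [P cpP]]]; rewrite ltnNge => /negP; apply.
have [->|P0] := eqVneq P set0; last exact: singular_le_multiple dcD cpP P0 g5.
by rewrite leq_eqVlt; apply/orP; left; apply/eqP/eq_card => A; rewrite !inE.
Qed.
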